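(* Let $m,n\ge1$, let $A\in\mathbb R^{m\times m}$, and let $\Pi^m_n\in\mathbb R^{n\times m}$ be the projection matrix from $\mathbb R^m$ to $\mathbb R^n$. The least square solution $A_\pi\in\mathbb R^{n\times n}$ of the matrix equation $\Pi^m_nA=A_\pi\Pi^m_n$ is $$A_\pi=\begin{cases}\Pi^m_nA(\Pi^m_n)^T\left(\Pi^m_n(\Pi^m_n)^T\right)^{-1}, & m\ge n,\\ \Pi^m_nA\left((\Pi^m_n)^T\Pi^m_n\right)^{-1}(\Pi^m_n)^T, & m<n.\end{cases}$$
   Context: For $m,n\ge1$ put $t=\mathrm{lcm}(m,n)$, $\alpha=t/m$, $\beta=t/n$. With $\mathbf 1_k\in\mathbb R^k$ the all-ones column vector, $I_k$ the $k\times k$ identity matrix and $\otimes$ the Kronecker product, the projection matrix from $\mathbb R^m$ to $\mathbb R^n$ is $\Pi^m_n:=\frac1\beta (I_n\otimes \mathbf 1_\beta^T)(I_m\otimes \mathbf 1_\alpha)\in\mathbb R^{n\times m}$. It has full row rank when $m\ge n$ and full column rank when $m\le n$, so the inverses above exist. The equation $\Pi^m_nA=A_\pi\Pi^m_n$ arises by requiring that $x(t)=\Pi^m_n\xi(t)$ satisfy $x(t+1)=A_\pi x(t)$ on $\mathbb R^n$ whenever $\xi(t+1)=A\xi(t)$ on $\mathbb R^m$, with $\xi(t)$ arbitrary. In general no $A_\pi$ satisfies this exactly, so a least square approximate system is sought. For $m\ge n$ the formula is obtained by right multiplying the equation by $(\Pi^m_n)^T$. For $m<n$ the solution is sought in the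 form $A_\pi=\tilde A(\Pi^m_n)^T$, with $\tilde A=\Pi^m_nA\left((\Pi^m_n)^T\Pi^m_n\right)^{-1}$ as the least square solution for $\tilde A$. *)

(* Defs.v *)
From mathcomp Require Export all_boot all_order all_algebra.
From mathcomp Require Export reals.
From mathcomp.real_closed Require Export mxtens.

Set Implicit Arguments.
Unset Strict Implicit.
Unset Printing Implicit Defensive.

Import GRing.Theory Num.Theory.
Local Open Scope ring_scope.

Definition ones (R : realType) (k : nat) : 'cV[R]_k := const_mx 1.

Lemma mul_lcmn_divl (m n : nat) : (m * (lcmn m n %/ m) = lcmn m n)%N.
Proof. by rewrite mulnC divnK // dvdn_lcml. Qed.

Lemma mul_lcmn_divr (m n : nat) : (n * (lcmn m n %/ n) = lcmn m n)%N.
Proof. by rewrite mulnC divnK // dvdn_lcmr. Qed.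

(* Pi^m_n, acting on column vectors of size m.  [*t] is the Kronecker product;
   the casts only identify the dimensions n * 1 with n, m * 1 with m, and both
   m * alpha and n * beta with lcm(m, n). *)
Definition projmx (R : realType) (m n : nat) : 'M[R]_(n, m) :=
  let alpha := (lcmn m n %/ m)%N in
  let beta := (lcmn m n %/ n)%N in
  beta%:R^-1 *:
    (castmx (muln1 n, mul_lcmn_divr m n) ((1%:M : 'M[R]_n) *t (ones R beta)^T)
     *m
     castmx (mul_lcmn_divl m n, muln1 m) ((1%:M : 'M[R]_m) *t ones R alpha)).

Definition frobenius_norm (R : realType) (p q : nat) (M : 'M[R]_(p, q)) : R :=
  Num.sqrt (\sum_(i < p) \sum_(j < q) M i j ^+ 2).

(* [X] is a least square solution of the matrix equation B = X *m C; such
   solutions always exist but need not be unique. *)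
Definition least_square_solution (R : realType) (p q r : nat)
    (C : 'M[R]_(q, r)) (B : 'M[R]_(p, r)) (X : 'M[R]_(p, q)) : Prop :=
  forall Y : 'M[R]_(p, q),
    frobenius_norm (B - X *m C) <= frobenius_norm (B - Y *m C).

(* Main.v *)
(* The squared Frobenius residual is a quadratic function of the unknown, so X
   is a least square solution of B = X C exactly when (B - X C) C^T = 0. It
   remains to see that Pi^m_n has full rank. Up to a scalar, its entries are
   the overlaps of the n blocks of length beta with the m blocks of length
   alpha that partition 0, ..., t - 1. When alpha <= beta, each beta-block
   contains the end of an alpha-block, which meets no later beta-block: the
   corresponding columns form a triangular submatrix with positive diagonal.
   Transposing exchanges m and n. *)
Require Import Defs.
From mathcomp Require Import zify ring lra.

Set Implicit Arguments.
Unset Strict Implicit.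
Unset Printing Implicit Defensive.

Import Order.TTheory GRing.Theory Num.Theory.
Local Open Scope ring_scope.

Definition frobenius_dot (R : realType) (p q : nat) (M N : 'M[R]_(p, q)) : R :=
  \tr (M *m N^T).

Lemma frobenius_dotE (R : realType) (p q : nat) (M N : 'M[R]_(p, q)) :
  frobenius_dot M N = \sum_(i < p) \sum_(j < q) M i j * N i j.
Proof.
rewrite /frobenius_dot /mxtrace; apply: eq_bigr => i _.
by rewrite mxE; apply: eq_bigr => j _; rewrite mxE.
Qed.

Lemma frobenius_dotC (R : realType) (p q : nat) (M N : 'M[R]_(p, q)) :
  frobenius_dot M N = frobenius_dot N M.
Proof. by rewrite /frobenius_dot -mxtrace_tr trmx_mul trmxK. Qed.

Lemma frobenius_dotZr (R : realType) (p q : nat) (e : R) (M N : 'M[R]_(p, q)) :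
  frobenius_dot M (e *: N) = e * frobenius_dot M N.
Proof. by rewrite /frobenius_dot linearZ -scalemxAr mxtraceZ. Qed.

Lemma frobenius_dot_ge0 (R : realType) (p q : nat) (M : 'M[R]_(p, q)) :
  0 <= frobenius_dot M M.
Proof.
rewrite frobenius_dotE; do 2![apply: sumr_ge0 => ? _].
by rewrite -expr2 sqr_ge0.
Qed.

Lemma frobenius_dot_eq0 (R : realType) (p q : nat) (M : 'M[R]_(p, q)) :
  frobenius_dot M M = 0 -> M = 0.
Proof.
rewrite frobenius_dotE => M0; apply/matrixP => i j; rewrite mxE.
have row_ge0 k : 0 <= \sum_(l < q) M k l * M k l.
  by apply: sumr_ge0 => l _; rewrite -expr2 sqr_ge0.
have Mi0 : \sum_(l < q) M i l * M i l = 0.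
  exact: (psumr_eq0P (fun k _ => row_ge0 k) M0).
have /eqP : M i j * M i j = 0.
  by apply: (psumr_eq0P _ Mi0) => // l _; rewrite -expr2 sqr_ge0.
by rewrite mulf_eq0 orbb => /eqP.
Qed.

Lemma frobenius_norm_le (R : realType) (p q : nat) (M N : 'M[R]_(p, q)) :
  (frobenius_norm M <= frobenius_norm N) =
  (frobenius_dot M M <= frobenius_dot N N).
Proof.
have sqE (K : 'M[R]_(p, q)) :
    \sum_(i < p) \sum_(j < q) K i j ^+ 2 = frobenius_dot K K.
  by rewrite frobenius_dotE; do 2![apply: eq_bigr => ? _]; rewrite expr2.
by rewrite /frobenius_norm !sqE ler_sqrt // frobenius_dot_ge0.
Qed.

Lemma frobenius_dotBB (R : realType) (p q : nat) (M N : 'M[R]_(p, q)) :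
  frobenius_dot (M - N) (M - N) =
  frobenius_dot M M - 2 * frobenius_dot M N + frobenius_dot N N.
Proof.
have -> : frobenius_dot (M - N) (M - N) =
    frobenius_dot M M - frobenius_dot M N
    - (frobenius_dot N M - frobenius_dot N N).
  rewrite /frobenius_dot raddfB mulmxBr !mulmxBl.
  by rewrite !(raddfB (mxtrace (n := p))) /=; ring.
by rewrite (frobenius_dotC N); ring.
Qed.

(** For a residual [D], this identifies [D *m C^T] as the gradient of the squared residual up to a
    factor. *)
Lemma frobenius_dot_mulr (R : realType) (p q r : nat)
    (D : 'M[R]_(p, r)) (Z : 'M[R]_(p, q)) (C : 'M[R]_(q, r)) :
  frobenius_dot D (Z *m C) = frobenius_dot (D *m C^T) Z.
Proof. by rewrite /frobenius_dot trmx_mul mulmxA. Qed.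

Lemma least_square_solutionP (R : realType) (p q r : nat)
    (C : 'M[R]_(q, r)) (B : 'M[R]_(p, r)) (X : 'M[R]_(p, q)) :
  least_square_solution C B X <-> (B - X *m C) *m C^T = 0.
Proof.
set D := B - X *m C.
have shiftE (Z : 'M[R]_(p, q)) :
    frobenius_dot (B - (X + Z) *m C) (B - (X + Z) *m C) = frobenius_dot D D
      - 2 * frobenius_dot (D *m C^T) Z + frobenius_dot (Z *m C) (Z *m C).
  by rewrite mulmxDl opprD addrA frobenius_dotBB frobenius_dot_mulr.
split=> [minX | normalX Y]; last first.
  (* With the cross term gone, passing from [X] to [Y] only adds the squared norm of
     [(Y - X) *m C]. *)
  rewrite -[Y](subrKC X) frobenius_norm_le shiftE -/D normalX.
  have -> : frobenius_dot 0 (Y - X) = 0.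
    by rewrite /frobenius_dot mul0mx mxtrace0.
  by have := frobenius_dot_ge0 ((Y - X) *m C); lra.
apply: frobenius_dot_eq0; move: shiftE; set G := D *m C^T => shiftE.
have g_ge0 := frobenius_dot_ge0 G; set g := frobenius_dot G G in g_ge0 *.
have k_ge0 := frobenius_dot_ge0 (G *m C); set k := frobenius_dot _ _ in k_ge0.
(* Perturbing X by e G changes the squared residual by - 2 e g + e^2 k. *)
have descent e : 2 * (e * g) <= e ^+ 2 * k.
  have := minX (X + e *: G).
  rewrite frobenius_norm_le shiftE -/D.
  rewrite frobenius_dotZr -/g.
  have -> : frobenius_dot (e *: G *m C) (e *: G *m C) = e ^+ 2 * k.
    by rewrite -scalemxAl frobenius_dotZr frobenius_dotC frobenius_dotZr mulrA.
  by lra.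
have k1_gt0 : 0 < k + 1 by lra.
(* The optimal step would be [g / k]; adding 1 covers [k = 0], and [descent e] still forces
   [e ^+ 2 * (k + 2) <= 0]. *)
set e := g / (k + 1); have gE : g = e * (k + 1) by rewrite divfK // gt_eqF.
have e2k_ge0 : 0 <= e ^+ 2 * k by rewrite mulr_ge0 // sqr_ge0.
have e2_le0 : e ^+ 2 <= 0 by have := descent e; rewrite gE; nra.
have /eqP : e ^+ 2 = 0 by apply/eqP; rewrite eq_le e2_le0 sqr_ge0.
by rewrite sqrf_eq0 gE => /eqP ->; rewrite mul0r.
Qed.

(** If [v *m M *m M^T = 0], then [v *m M] has squared norm 0, so [v = 0] by row freeness. *)
Lemma gram_unitmx (R : realType) (p q : nat) (M : 'M[R]_(p, q)) :
  row_free M -> M *m M^T \in unitmx.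
Proof.
move=> freeM; rewrite -row_free_unit; apply: inj_row_free => v vMM0.
apply/eqP; rewrite -(mulmx_free_eq0 _ freeM); apply/eqP/frobenius_dot_eq0.
by rewrite /frobenius_dot trmx_mul !mulmxA -(mulmxA v) vMM0 mul0mx mxtrace0.
Qed.

(** Keeping [t], [b], [a] independent of the lcm lets one rank lemma serve both a projection matrix
    and its transpose. *)
Definition block_overlap (R : realType) (t b a n m : nat) : 'M[R]_(n, m) :=
  \matrix_(i, j) \sum_(k < t) ((k %/ b == i)%N && (k %/ a == j)%N)%:R.

Lemma tr_block_overlap (R : realType) (t b a n m : nat) :
  (block_overlap R t b a n m)^T = block_overlap R t a b m n.
Proof.
by apply/matrixP => i j; rewrite !mxE; apply: eq_bigr => k _; rewrite andbC.
Qed.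

Lemma row_free_block_overlap (R : realType) (t b a n m : nat) :
  (0 < a <= b)%N -> t = (n * b)%N -> t = (m * a)%N ->
  row_free (block_overlap R t b a n m).
Proof.
move=> /andP[a_gt0 le_ab] tnb tma; have b_gt0 := leq_trans a_gt0 le_ab.
apply: inj_row_free => v vM0.
(* Forward substitution: the coordinates of [v] vanish in increasing order. *)
suff v0 s (i : 'I_n) : (i < s)%N -> v 0 i = 0.
  by apply/rowP => i; rewrite mxE (v0 i.+1).
elim: s i => [//|s IHs] i; rewrite ltnS leq_eqVlt => /orP[/eqP iE | /IHs //].
(* The last a-block ending inside the i-th b-block meets no later b-block. *)
pose e := (i.+1 * b %/ a)%N.
have e_le : (e * a <= i.+1 * b)%N by exact: leq_trunc_div.
have e_gt : (i.+1 * b < e.+1 * a)%N by rewrite -ltn_divLR.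
(* Here [a <= b] enters: the chosen a-block ends after the start of the i-th b-block. *)
have ib_lt : (i * b < e * a)%N by rewrite !mulSn in e_gt; lia.
have ea_le : (e * a <= t)%N.
  by rewrite (leq_trans e_le) // tnb leq_mul2r ltn_ord orbT.
have e_gt0 : (0 < e)%N by case: (e) ib_lt.
have j_lt : (e.-1 < m)%N by rewrite prednK // -(leq_pmul2r a_gt0) -tma.
have k_lt : ((e * a).-1 < t)%N by lia.
pose j := Ordinal j_lt; pose k := Ordinal k_lt.
have := congr1 (fun w : 'rV[R]_m => w 0 j) vM0.
rewrite !mxE (bigD1 i) //= [X in _ + X]big1 => [|i' ne_i'i]; last first.
  have [lt_i'i|lt_ii'|/val_inj eq_i'i] := ltngtP i' i.
  - by rewrite IHs ?mul0r // -iE.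
  - rewrite mxE big1 ?mulr0 // => l _; case: andP => //= -[/eqP lb /eqP la].
    have : (l < e * a)%N by rewrite -ltn_divLR // la prednK.
    have : (i' * b <= l)%N by rewrite -lb leq_trunc_div.
    have : (i.+1 * b <= i' * b)%N by rewrite leq_mul2r lt_ii' orbT.
    lia.
  - by rewrite eq_i'i eqxx in ne_i'i.
(* The diagonal entry is positive: [k], the last point of the a-block, lies in both blocks and
   contributes 1. *)
move/eqP; rewrite addr0 mulf_eq0 => /orP[/eqP // |].
rewrite mxE (bigD1 k) //= gt_eqF // ltr_wpDr //.
  by apply: sumr_ge0 => l _; rewrite ler0n.
have -> : ((e * a).-1 %/ b == i)%N.
  by rewrite eqn_leq -ltnS ltn_divLR // leq_divRL //; apply/andP; split; lia.
have -> : ((e * a).-1 %/ a == e.-1)%N.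
  rewrite eqn_leq -ltnS ltn_divLR // leq_divRL // (prednK e_gt0).
  have ea : (e.-1 * a + a = e * a)%N by rewrite -mulSnr prednK.
  by apply/andP; split; lia.
by rewrite ltr01.
Qed.

(** Both Kronecker factors are 0-1 indicators of block membership, and the inner index of their
    product runs over the points [k]. *)
Lemma projmxE (R : realType) (m n : nat) :
  projmx R m n = (lcmn m n %/ n)%:R^-1 *:
    block_overlap R (lcmn m n) (lcmn m n %/ n) (lcmn m n %/ m) n m.
Proof.
rewrite /projmx; congr (_ *: _); apply/matrixP => i j; rewrite !mxE.
apply: eq_bigr => k _; rewrite !castmxE !mxE /= !mulr1 -natrM mulnb.
by rewrite -!val_eqE /= !divn1 eq_sym.
Qed.

Lemma lcmn_div_ord (m n : nat) : (0 < n <= m)%N ->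
  (0 < lcmn m n %/ m <= lcmn m n %/ n)%N.
Proof.
move=> /andP[n_gt0 le_nm]; have m_gt0 := leq_trans n_gt0 le_nm.
rewrite divn_gt0 // leq_div2l // andbT.
by rewrite dvdn_leq ?dvdn_lcml // lcmn_gt0 m_gt0.
Qed.

Lemma row_free_projmx (R : realType) (m n : nat) :
  (0 < n <= m)%N -> row_free (projmx R m n).
Proof.
move=> ord_nm; have ord_lcm := lcmn_div_ord ord_nm.
have [a_gt0 le_ab] := andP ord_lcm.
rewrite projmxE /row_free eqmx_scale; last first.
  by rewrite invr_eq0 pnatr_eq0 -lt0n (leq_trans a_gt0).
by apply: row_free_block_overlap; rewrite ?mul_lcmn_divl ?mul_lcmn_divr.
Qed.

Lemma row_free_tr_projmx (R : realType) (m n : nat) :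
  (0 < m <= n)%N -> row_free (projmx R m n)^T.
Proof.
move=> ord_mn; have := lcmn_div_ord ord_mn; rewrite lcmnC => ord_lcm.
rewrite projmxE linearZ /= tr_block_overlap /row_free eqmx_scale; last first.
  by rewrite invr_eq0 pnatr_eq0 -lt0n; case/andP: ord_lcm.
by apply: row_free_block_overlap; rewrite ?mul_lcmn_divl ?mul_lcmn_divr.
Qed.

Theorem mainTheorem3 (R : realType) (m n : nat) (hm : (1 <= m)%N) (hn : (1 <= n)%N)
    (A : 'M[R]_m) :
  let P : 'M[R]_(n, m) := projmx R m n in
  ((n <= m)%N ->
     P *m P^T \in unitmx /\
     forall X : 'M[R]_n,
       least_square_solution P (P *m A) X <->
       X = P *m A *m P^T *m invmx (P *m P^T))
  /\
  ((m < n)%N ->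
     [/\ P^T *m P \in unitmx,
         forall Atilde : 'M[R]_(n, m),
           least_square_solution (P^T *m P) (P *m A) Atilde <->
           Atilde = P *m A *m invmx (P^T *m P)
       & forall X : 'M[R]_n,
           least_square_solution P (P *m A) X /\
           (exists Atilde : 'M[R]_(n, m), X = Atilde *m P^T) <->
           X = P *m A *m invmx (P^T *m P) *m P^T]).
Proof.
move=> P; split=> [le_nm | lt_mn].
  have uPP : P *m P^T \in unitmx.
    by apply/gram_unitmx/row_free_projmx; rewrite hn.
  (* The normal equation becomes [P *m A *m P^T = X *m (P *m P^T)], with an invertible Gram
     matrix. *)
  split=> // X; rewrite least_square_solutionP mulmxBl -(mulmxA X).
  split=> [/eqP + | ->]; first by rewrite subr_eq0 => /eqP ->; rewrite mulmxK.
  by rewrite mulmxKV // subrr.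
have freePt : row_free P^T by apply: row_free_tr_projmx; rewrite hm ltnW.
have uPP : P^T *m P \in unitmx.
  by rewrite -{2}[P]trmxK; apply: gram_unitmx.
split=> // [Atilde | X].
  (* The transposed Gram matrix cancels from the normal equation, so the residual is zero. *)
  rewrite least_square_solutionP; split=> [/eqP | ->].
    rewrite mulmx_free_eq0 ?row_free_unit ?unitmx_tr // subr_eq0 => /eqP ->.
    by rewrite mulmxK.
  by rewrite mulmxKV // subrr mul0mx.
(* Row freeness of [P^T] reduces the normal equation to [P *m A = X *m P]; the form [Atilde *m P^T]
   then singles out one solution. *)
rewrite least_square_solutionP; split=> [[/eqP + [Atilde XE]] | ->].
  rewrite mulmx_free_eq0 // subr_eq0 XE -(mulmxA Atilde) => /eqP ->.
  by rewrite mulmxK.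
split; last by exists (P *m A *m invmx (P^T *m P)).
by rewrite -(mulmxA _ P^T) mulmxKV // subrr mul0mx.
Qed.
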